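(* Let $n\ge1$ be an integer and let $V$ be a unitary $(\mathfrak g,K)$-module whose set of $K$-highest weights is exactly $$\{(n+p+q,\,2p-2q,\,n+p+q): p,q\in\mathbb Z_{\ge0}\},$$ each occurring with multiplicity one. For $p,q\ge0$ and $\delta\in\{\beta,\alpha+\beta+\gamma\}$, let $A_\delta B_\delta(p,q)$ and $B_\delta A_\delta(p,q)$ denote the scalars by which $A_\delta B_\delta$ and $B_\delta A_\delta$ act on the highest weight vectors of weight $(n+p+q,2p-2q,n+p+q)$. Then for all $p,q\ge0$ $$A_\beta B_\beta(p,q)=-(q+1)(n+q+1)(n+p+q+1)(n+p+q+2),$$ $$B_{\alpha+\beta+\gamma}A_{\alpha+\beta+\gamma}(p,q)=-(p+1)(n+p+1)(n+p+q+1)(n+p+q+2),$$ $$B_\beta A_\beta(p,q)=-q(n+q)(n+p+q)(n+p+q+1),$$ $$A_{\alpha+\beta+\gamma}B_{\alpha+\beta+\gamma}(p,q)=-p(n+p)(n+p+q)(n+p+q+1).$$ Moreover, writing $M=n+p+q$, these formulas satisfy the scalar equations $$\tfrac{1}{(M+2)^2}A_\beta B_\beta-\tfrac1{(M+1)^2}B_\beta A_\beta-\tfrac1{(M+1)^2(M+2)^2}B_{\alpha+\beta+\gamma}A_{\alpha+\beta+\gamma}=-n-2q,$$ $$\tfrac1{(M+1)(M+2)^2}A_\beta B_\beta-\tfrac1{(M+1)(M+2)^2}B_{\alpha+\beta+\gamma}A_{\alpha+\beta+\gamma}=p-q$$ (this equation being counted twice), $$\tfrac1{(M+1)^2}A_{\alpha+\beta+\gamma}B_{\alpha+\beta+\gamma}-\tfrac1{(M+2)^2}B_{\alpha+\beta+\gamma}A_{\alpha+\beta+\gamma}+\tfrac1{(M+1)^2(M+2)^2}A_\beta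 B_\beta=n+2p$$ (all coefficients evaluated at $(p,q)$), and, as identities between the right-hand side expressions above, the two predecessor identities $$B_\beta A_\beta(p,q)=A_\beta B_\beta(p,q-1),\qquad A_{\alpha+\beta+\gamma}B_{\alpha+\beta+\gamma}(p,q)=B_{\alpha+\beta+\gamma}A_{\alpha+\beta+\gamma}(p-1,q);$$ and all these coefficients are nonpositive.
   Context: Let $\mathfrak g=\mathfrak{sl}(4,\mathbb C)$ with matrix units $E_{ij}$, and let $K=S(U(2)\times U(2))$ (block diagonal) be the maximal compact subgroup of $SU(2,2)$. Let $\mathfrak g_0=\mathfrak{su}(2,2)=\{X\in M_4(\mathbb C): \operatorname{tr}X=0,\ \overline{X}^{t}J+JX=0\}$ with $J=\operatorname{diag}(1,1,-1,-1)$. Put $H_\alpha=E_{11}-E_{22}$, $H_\beta=E_{22}-E_{33}$, $H_\gamma=E_{33}-E_{44}$; $X_\alpha=E_{12}$, $X_\beta=E_{23}$, $X_\gamma=E_{34}$, $X_{\alpha+\beta}=E_{13}$, $X_{\beta+\gamma}=E_{24}$, $X_{\alpha+\beta+\gamma}=E_{14}$; and $Y_\delta=X_\delta^{t}$ (transpose) for each positive root $\delta$. Put $H_0=H_\alpha+2H_\beta+H_\gamma$. A unitary $(\mathfrak g,K)$-module $V$ is an admissible $(\mathfrak g,K)$-module with a positive-definite Hermitian inner product such that $(Xv,w)=-(v,Xw)$ for all $X\in\mathfrak g_0$, $v,w\in V$. A $K$-highest weight vector of weight $(n,k,m)$ ($n,m\in\mathbb Z_{\ge0}$, $k\in\mathbb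 Z$) is $v\in V$ with $X_\alpha v=X_\gamma v=0$, $H_\alpha v=nv$, $H_\gamma v=mv$, $H_0v=kv$ (so $H_\beta v=\tfrac12(k-n-m)v$). The set of $K$-highest weights of $V$ is the set of weights of its nonzero $K$-highest weight vectors; a weight has multiplicity one if its space of highest weight vectors is one-dimensional. The following operators map $K$-highest weight vectors to $K$-highest weight vectors (products are compositions, the rightmost factor acting first): $A_{\alpha+\beta+\gamma}=X_{\alpha+\beta+\gamma}$, shifting weights by $(1,2,1)$; $A_\beta=X_\beta(H_\alpha+1)(H_\gamma+1)-Y_\alpha X_{\alpha+\beta}(H_\gamma+1)+Y_\gamma X_{\beta+\gamma}(H_\alpha+1)-Y_\alpha Y_\gamma X_{\alpha+\beta+\gamma}$, shifting weights by $(-1,2,-1)$; $B_{\alpha+\beta+\gamma}=Y_{\alpha+\beta+\gamma}(H_\alpha+1)(H_\gamma+1)+Y_\alpha Y_{\beta+\gamma}(H_\gamma+1)-Y_\gamma Y_{\alpha+\beta}(H_\alpha+1)-Y_\alpha Y_\gamma Y_\beta$, shifting weights by $(-1,-2,-1)$; $B_\beta=Y_\beta$, shifting weights by $(1,-2,1)$. *)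

(* Defs.v *)
From HB Require Import structures.
From mathcomp Require Import all_boot all_order all_algebra.
From mathcomp Require Import complex.
From mathcomp Require Import all_classical all_reals all_analysis.

Set Implicit Arguments.
Unset Strict Implicit.
Unset Printing Implicit Defensive.

Import Order.TTheory GRing.Theory Num.Theory numFieldNormedType.Exports.
Local Open Scope classical_set_scope.
Local Open Scope ring_scope.
Local Open Scope complex_scope.

(* Typed as a numClosedFieldType, rather than left as R[i], so that the canonical
   topology of a numFieldType, and that of matrices over it, is inferred. *)
Definition Cplx (R : realType) : numClosedFieldType := R[i].

(* Matrix units with the usual indices 1, ..., 4. *)
Definition E (R : realType) (i j : nat) : 'M[Cplx R]_4 :=
  delta_mx (inord i.-1) (inord j.-1).

Definition Ha (R : realType) : 'M[Cplx R]_4 := E R 1 1 - E R 2 2.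
Definition Hb (R : realType) : 'M[Cplx R]_4 := E R 2 2 - E R 3 3.
Definition Hg (R : realType) : 'M[Cplx R]_4 := E R 3 3 - E R 4 4.
Definition H0 (R : realType) : 'M[Cplx R]_4 := Ha R + 2%:R *: Hb R + Hg R.
Definition Xa (R : realType) : 'M[Cplx R]_4 := E R 1 2.
Definition Xb (R : realType) : 'M[Cplx R]_4 := E R 2 3.
Definition Xg (R : realType) : 'M[Cplx R]_4 := E R 3 4.
Definition Xab (R : realType) : 'M[Cplx R]_4 := E R 1 3.
Definition Xbg (R : realType) : 'M[Cplx R]_4 := E R 2 4.
Definition Xabg (R : realType) : 'M[Cplx R]_4 := E R 1 4.
Definition Ya (R : realType) : 'M[Cplx R]_4 := (Xa R)^T.
Definition Yb (R : realType) : 'M[Cplx R]_4 := (Xb R)^T.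
Definition Yg (R : realType) : 'M[Cplx R]_4 := (Xg R)^T.
Definition Yab (R : realType) : 'M[Cplx R]_4 := (Xab R)^T.
Definition Ybg (R : realType) : 'M[Cplx R]_4 := (Xbg R)^T.
Definition Yabg (R : realType) : 'M[Cplx R]_4 := (Xabg R)^T.

Definition sl4 (R : realType) : set 'M[Cplx R]_4 := [set X | \tr X = 0].

Definition Jmx (R : realType) : 'M[Cplx R]_4 :=
  diag_mx (\row_(j < 4) (if (j < 2)%N then 1 else -1)).

Definition su22 (R : realType) : set 'M[Cplx R]_4 :=
  [set X | \tr X = 0 /\ (map_mx Num.conj X)^T *m Jmx R + Jmx R *m X = 0].

Definition block_diagonal (R : realType) (X : 'M[Cplx R]_4) : Prop :=
  forall i j : 'I_4, (i < 2)%N != (j < 2)%N -> X i j = 0.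

(* S(U(2) x U(2)) *)
Definition Kgroup (R : realType) : set 'M[Cplx R]_4 :=
  [set k | [/\ k \is unitarymx, \det k = 1 & block_diagonal k]].

Definition Klie (R : realType) : set 'M[Cplx R]_4 :=
  [set X | su22 X /\ block_diagonal X].

Definition expmx (R : realType) (X : 'M[Cplx R]_4) : 'M[Cplx R]_4 :=
  lim (series (fun k : nat => (k`!%:R)^-1 *: X ^+ k) @ \oo).

(* A representation on column vectors; only the values on Kgroup matter. *)
Definition Krep (R : realType) (m : nat)
    (rho : 'M[Cplx R]_4 -> 'M[Cplx R]_m) : Prop :=
  [/\ rho 1%:M = 1%:M,
      forall k l, Kgroup k -> Kgroup l -> rho (k *m l) = rho k *m rho l &
      forall i j : 'I_m, {within @Kgroup R, continuous (fun k => rho k i j)}].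

(* The row space of U, transposed, is a subspace of column vectors. *)
Definition Kirreducible (R : realType) (m : nat)
    (rho : 'M[Cplx R]_4 -> 'M[Cplx R]_m) : Prop :=
  (0 < m)%N /\
  forall U : 'M[Cplx R]_m, (forall k, Kgroup k -> stablemx U (rho k)^T) ->
    \rank U = 0%N \/ \rank U = m.

(* D is the value at X of the differential of rho. *)
Definition is_Kdifferential (R : realType) (m : nat)
    (rho : 'M[Cplx R]_4 -> 'M[Cplx R]_m) (X : 'M[Cplx R]_4)
    (D : 'M[Cplx R]_m) : Prop :=
  forall i j : 'I_m,
    (fun t : R => (t^-1)%:C * (rho (expmx (t%:C *: X)) i j - rho 1%:M i j)
                  : Cplx R)
      @ (0 : R)^' --> D i j.

(* The linear map sending the j-th basis vector of the space of rho to e j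
   intertwines rho and the action of Kgroup on V. *)
Definition Kintertwines (R : realType) (V : lmodType (Cplx R))
    (act : 'M[Cplx R]_4 -> V -> V) (m : nat)
    (rho : 'M[Cplx R]_4 -> 'M[Cplx R]_m) (e : 'I_m -> V) : Prop :=
  forall k, Kgroup k ->
    forall j, act k (e j) = \sum_(i < m) rho k i j *: e i.

(* Both actions are given on all 4 x 4 matrices, but constrained only on sl4,
   resp. Kgroup: values elsewhere are irrelevant. *)
Record gK_module (R : realType) (V : lmodType (Cplx R)) := GKModule {
  gact : 'M[Cplx R]_4 -> {linear V -> V};
  kact : 'M[Cplx R]_4 -> {linear V -> V};
  gact_linear : forall (a : Cplx R) X Y v, sl4 X -> sl4 Y ->
    gact (a *: X + Y) v = a *: gact X v + gact Y v;
  gact_bracket : forall X Y v, sl4 X -> sl4 Y ->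
    gact (X *m Y - Y *m X) v = gact X (gact Y v) - gact Y (gact X v);
  kact1 : forall v, kact 1%:M v = v;
  kactM : forall k l v, Kgroup k -> Kgroup l ->
    kact (k *m l) v = kact k (kact l v);
  (* V is a union of finite-dimensional continuous K-submodules. *)
  kact_finite : forall v, exists m (rho : 'M[Cplx R]_4 -> 'M[Cplx R]_m)
      (e : 'I_m -> V) (c : 'I_m -> Cplx R),
    [/\ Krep rho, Kintertwines (fun k => kact k) rho e &
        v = \sum_(i < m) c i *: e i];
  (* The differential of the action of K is the action of its Lie algebra. *)
  kact_differential : forall m (rho : 'M[Cplx R]_4 -> 'M[Cplx R]_m)
      (e : 'I_m -> V),
    Krep rho -> Kintertwines (fun k => kact k) rho e ->
    forall X, Klie X -> exists2 D : 'M[Cplx R]_m, is_Kdifferential rho X D &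
      forall j, gact X (e j) = \sum_(i < m) D i j *: e i;
  kact_Ad : forall k X v, Kgroup k -> sl4 X ->
    kact k (gact X v) = gact (k *m X *m invmx k) (kact k v)
}.

(* Every irreducible representation of K has finite multiplicity, i.e. the
   intertwining maps from it to V span a finite-dimensional space. *)
Definition admissible (R : realType) (V : lmodType (Cplx R))
    (pi : gK_module V) : Prop :=
  forall m (rho : 'M[Cplx R]_4 -> 'M[Cplx R]_m), Krep rho -> Kirreducible rho ->
  exists N (f : 'I_N -> 'I_m -> V), forall e : 'I_m -> V,
    Kintertwines (fun k => kact pi k) rho e ->
    exists c : 'I_N -> Cplx R, forall j, e j = \sum_(s < N) c s *: f s j.

Definition unitary_gK_module (R : realType) (V : lmodType (Cplx R))
    (pi : gK_module V) : Prop :=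
  admissible pi /\
  exists form : {dot V for Num.conj}, forall X, su22 X ->
    forall v w, form (gact pi X v) w = - form v (gact pi X w).

(* Vectors, zero included, of weight w = (n, k, m). *)
Definition hw_vectors (R : realType) (V : lmodType (Cplx R))
    (pi : gK_module V) (w : nat * int * nat) : set V :=
  let: (n, k, m) := w in
  [set v | [/\ gact pi (Xa R) v = 0, gact pi (Xg R) v = 0,
               gact pi (Ha R) v = n%:R *: v, gact pi (Hg R) v = m%:R *: v &
               gact pi (H0 R) v = k%:~R *: v]].

Definition K_highest_weights (R : realType) (V : lmodType (Cplx R))
    (pi : gK_module V) : set (nat * int * nat) :=
  [set w | exists2 v, hw_vectors pi w v & v != 0].

Definition multiplicity_one (R : realType) (V : lmodType (Cplx R))
    (pi : gK_module V) (w : nat * int * nat) : Prop :=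
  exists v, [/\ hw_vectors pi w v, v != 0 &
    forall v', hw_vectors pi w v' -> exists c : Cplx R, v' = c *: v].

Definition ladder_weight (n p q : nat) : nat * int * nat :=
  ((n + p + q)%N, 2 * p%:Z - 2 * q%:Z, (n + p + q)%N).

(* W is required to be nonzero, so that c is determined by T and W. *)
Definition acts_by_scalar (R : realType) (V : lmodType (Cplx R))
    (T : V -> V) (W : set V) (c : Cplx R) : Prop :=
  (exists2 v, W v & v != 0) /\ forall v, W v -> T v = c *: v.

Definition act1 (R : realType) (V : lmodType (Cplx R)) (pi : gK_module V)
    (X : 'M[Cplx R]_4) (v : V) : V := gact pi X v + v.

Definition A_abg (R : realType) (V : lmodType (Cplx R)) (pi : gK_module V)
    (v : V) : V := gact pi (Xabg R) v.

Definition A_b (R : realType) (V : lmodType (Cplx R)) (pi : gK_module V)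
    (v : V) : V :=
  gact pi (Xb R) (act1 pi (Ha R) (act1 pi (Hg R) v))
  - gact pi (Ya R) (gact pi (Xab R) (act1 pi (Hg R) v))
  + gact pi (Yg R) (gact pi (Xbg R) (act1 pi (Ha R) v))
  - gact pi (Ya R) (gact pi (Yg R) (gact pi (Xabg R) v)).

Definition B_abg (R : realType) (V : lmodType (Cplx R)) (pi : gK_module V)
    (v : V) : V :=
  gact pi (Yabg R) (act1 pi (Ha R) (act1 pi (Hg R) v))
  + gact pi (Ya R) (gact pi (Ybg R) (act1 pi (Hg R) v))
  - gact pi (Yg R) (gact pi (Yab R) (act1 pi (Ha R) v))
  - gact pi (Ya R) (gact pi (Yg R) (gact pi (Yb R) v)).

Definition B_b (R : realType) (V : lmodType (Cplx R)) (pi : gK_module V)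
    (v : V) : V := gact pi (Yb R) v.

Definition AbBb_expr (F : comPzRingType) (n p q : F) : F :=
  - ((q + 1) * (n + q + 1) * (n + p + q + 1) * (n + p + q + 2%:R)).

Definition BabgAabg_expr (F : comPzRingType) (n p q : F) : F :=
  - ((p + 1) * (n + p + 1) * (n + p + q + 1) * (n + p + q + 2%:R)).

Definition BbAb_expr (F : comPzRingType) (n p q : F) : F :=
  - (q * (n + q) * (n + p + q) * (n + p + q + 1)).

Definition AabgBabg_expr (F : comPzRingType) (n p q : F) : F :=
  - (p * (n + p) * (n + p + q) * (n + p + q + 1)).

(* Main.v *)
Require Import Defs.
From HB Require Import structures.
From mathcomp Require Import all_boot all_order all_algebra.
From mathcomp Require Import complex.
From mathcomp Require Import all_classical all_reals all_analysis.
From mathcomp Require Import ring zify.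
Import Order.TTheory GRing.Theory Num.Theory numFieldNormedType.Exports.
Local Open Scope classical_set_scope.
Local Open Scope ring_scope.

(** Let [v] be a highest weight vector of weight [(M, k, M)], with
    [M = n + p + q]. A highest weight vector of weight [(M - 1, _, M + 1)] or
    [(M + 1, _, M - 1)] is zero, since no such weight is on the ladder. This gives
    four relations ([vanishing_relations]), where [Eij v] is the action on [v]:
      [(M + 1) E24 v = E21 E14 v],    [(M + 1) E13 v = - E43 E14 v],
      [(M + 1) E31 v = - E21 E32 v],  [(M + 1) E42 v = E43 E32 v].
    They reduce [A_b v] to [(M + 1)^2 E23 v + E21 E43 E14 v], and [B_abg v] to
    [(M + 1)^2 E41 v + E21 E43 E32 v]. Using them at [v], [E14 v] and [E32 v], one
    rewrites [A_b B_b v], [B_abg A_abg v] and [B_b A_b v] as combinations of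
    [x = E23 E32 v], [y = E41 E14 v], [z = E21 E42 E14 v] and [v]. The commutators
    [[E13, E31]] and [[E23, E32]] then give two linear relations between the three
    compositions ([relation_diff], [relation_Hb]).

    By multiplicity one, [B_b A_b] at [(p, q + 1)] is the same scalar as
    [A_b B_b] at [(p, q)] ([swap_scalar]), and [A_b] kills the vectors with
    [q = 0]. The two relations therefore determine [A_b B_b] by induction on [q]:
    its coefficient after elimination is [M (M + 2)], which is nonzero. The second
    composition [B_abg A_abg] follows from [relation_diff], and the remaining two
    scalars from the same exchange argument. *)

Set Implicit Arguments.
Unset Strict Implicit.
Unset Printing Implicit Defensive.

(** * Matrix units and diagonal matrices *)

(** The range of the indices of the matrix units [E i j]. *)
Definition index4 (i : nat) := (0 < i <= 4)%N.

Section MatrixUnits.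
Variable R : realType.
Notation E := (@E R).

Lemma inord4_eq (i j : nat) : index4 i -> index4 j ->
  ((inord i.-1 : 'I_4) == inord j.-1) = (i == j).
Proof.
case: i => [//|i]; case: j => [//|j] /= hi hj.
by rewrite -val_eqE /= !inordK // eqSS.
Qed.

Lemma E_mul (i j k l : nat) : index4 j -> index4 k ->
  E i j *m E k l = E i l *+ (j == k).
Proof. by move=> hj hk; rewrite /Defs.E mul_delta_mx_cond inord4_eq. Qed.

Lemma E_tr (i j : nat) : (E i j)^T = E j i.
Proof. by rewrite /Defs.E trmx_delta. Qed.

Lemma sl4_E (i j : nat) : index4 i -> index4 j -> i != j ->
  sl4 (E i j).
Proof.
move=> hi hj ij; rewrite /sl4 /= /Defs.E /mxtrace big1 // => k _.
rewrite mxE; case: eqP => [->|//]; rewrite inord4_eq //.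
by rewrite (negbTE ij).
Qed.

Lemma sl4_0 : sl4 (0 : 'M[Cplx R]_4).
Proof. by rewrite /sl4 /= mxtrace0. Qed.

Lemma sl4D (X Y : 'M[Cplx R]_4) : sl4 X -> sl4 Y -> sl4 (X + Y).
Proof. by rewrite /sl4 /= => hX hY; rewrite mxtraceD hX hY addr0. Qed.

Lemma sl4Z (c : Cplx R) (X : 'M[Cplx R]_4) : sl4 X -> sl4 (c *: X).
Proof. by rewrite /sl4 /= => hX; rewrite mxtraceZ hX mulr0. Qed.

Lemma mxtrace_E (i : nat) : \tr (E i i) = 1.
Proof.
rewrite /Defs.E /mxtrace (bigD1 (inord i.-1)) //= mxE !eqxx big1 ?addr0 // => k.
by rewrite mxE => /negbTE ->.
Qed.

Lemma sl4_diag (i j : nat) : sl4 (E i i - E j j).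
Proof. by rewrite /sl4 /= raddfB /= !mxtrace_E subrr. Qed.

(** [X] is an eigenvector of [ad D], with eigenvalue [c]. *)
Definition ad_eigen (c : Cplx R) (X D : 'M[Cplx R]_4) :=
  D *m X - X *m D = c *: X.

Lemma ad_eigenD (c d : Cplx R) X D D' :
  ad_eigen c X D -> ad_eigen d X D' -> ad_eigen (c + d) X (D + D').
Proof.
rewrite /ad_eigen => h h'.
by rewrite mulmxDl mulmxDr scalerDl -h -h' opprD addrACA.
Qed.

Lemma ad_eigenZ (c d : Cplx R) X D :
  ad_eigen c X D -> ad_eigen (d * c) X (d *: D).
Proof.
by rewrite /ad_eigen => h; rewrite -scalemxAl -scalemxAr -scalerA -h scalerBr.
Qed.

Lemma ad_eigenB (c d : Cplx R) X D D' :
  ad_eigen c X D -> ad_eigen d X D' -> ad_eigen (c - d) X (D - D').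
Proof.
move=> h h'; apply: ad_eigenD => //.
by rewrite /ad_eigen mulNmx mulmxN opprK scaleNr -h' opprB addrC.
Qed.

Lemma ad_eigen_E (i k l : nat) :
  index4 i -> index4 k -> index4 l ->
  ad_eigen ((i == k)%:R - (i == l)%:R) (E k l) (E i i).
Proof.
move=> hi hk hl; rewrite /ad_eigen !E_mul // scalerBl (eq_sym l) !scaler_nat.
by congr (_ - _); case: eqP => [->|].
Qed.

End MatrixUnits.

(** * Commutation of matrix units acting on the module *)

Section Module.
Variables (R : realType) (V : lmodType (Cplx R)) (pi : gK_module V).
Notation E := (@E R).
Notation e i j := (gact pi (E i j)).

Lemma gactD X Y v : sl4 X -> sl4 Y ->
  gact pi (X + Y) v = gact pi X v + gact pi Y v.
Proof. by move=> hX hY; have := gact_linear pi 1 v hX hY; rewrite !scale1r. Qed.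

Lemma gact0 v : gact pi 0 v = 0.
Proof.
have := gactD v (sl4_0 R) (sl4_0 R); rewrite addr0 => /eqP.
by rewrite -subr_eq subrr eq_sym => /eqP.
Qed.

Lemma gactZ c X v : sl4 X -> gact pi (c *: X) v = c *: gact pi X v.
Proof.
by move=> hX; have := gact_linear pi c v hX (sl4_0 R); rewrite !addr0 gact0 addr0.
Qed.

Lemma gact_bracketE X Y Z v : sl4 X -> sl4 Y -> X *m Y - Y *m X = Z ->
  gact pi X (gact pi Y v) = gact pi Y (gact pi X v) + gact pi Z v.
Proof. by move=> hX hY <-; rewrite gact_bracket // addrC subrK. Qed.

Lemma gact_ad_eigen a c X D v : sl4 X -> sl4 D -> ad_eigen c X D ->
  gact pi D v = a *: v -> gact pi D (gact pi X v) = (a + c) *: gact pi X v.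
Proof.
move=> hX hD hc hv.
by rewrite (gact_bracketE v hD hX hc) hv linearZ gactZ // -scalerDl.
Qed.

(** The four cases of [[Eij, Ekl] = delta_jk Eil - delta_li Ekj] with [i != j]
    and [k != l]: none, the first, the second, or both of [j = k], [l = i]. *)
Lemma e_comm0 i j k l v :
  index4 i -> index4 j -> index4 k -> index4 l ->
  i != j -> k != l -> j != k -> l != i ->
  e i j (e k l v) = e k l (e i j v).
Proof.
move=> hi hj hk hl ij kl /negbTE jk /negbTE li.
rewrite (@gact_bracketE _ _ 0) ?gact0 ?addr0 //; try exact: sl4_E.
by rewrite !E_mul // jk li subrr.
Qed.

Lemma e_commr i j l v : index4 i -> index4 j -> index4 l -> i != j -> j != l ->
  l != i -> e i j (e j l v) = e j l (e i j v) + e i l v.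
Proof.
move=> hi hj hl ij jl li.
rewrite (@gact_bracketE _ _ (E i l)) //; try exact: sl4_E.
by rewrite !E_mul // eqxx (negbTE li) subr0.
Qed.

Lemma e_comml i j k v : index4 i -> index4 j -> index4 k -> i != j -> k != i ->
  j != k -> e i j (e k i v) = e k i (e i j v) - e k j v.
Proof.
move=> hi hj hk ij ki jk; rewrite (e_commr v hk hi hj) ?addrK // eq_sym //.
Qed.

Lemma e_commH i j v : index4 i -> index4 j -> i != j ->
  e i j (e j i v) = e j i (e i j v) + gact pi (E i i - E j j) v.
Proof.
move=> hi hj ij.
rewrite (@gact_bracketE _ _ (E i i - E j j)) //; try (apply: sl4_E => //).
  by rewrite eq_sym.
by rewrite !E_mul // !eqxx.
Qed.

(** * Weights and highest weight vectors *)

(** [v] has eigenvalues [a], [k], [c] under [Ha], [H0], [Hg]; the order is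
    that of the weights [(n, k, m)]. Zero is allowed. *)
Definition weight (a k c : Cplx R) (v : V) :=
  [/\ gact pi (Ha R) v = a *: v, gact pi (Hg R) v = c *: v &
      gact pi (H0 R) v = k *: v].

(** The values on [Ha], [Hb] and [Hg] of the root of [E k l]. *)
Definition ra (k l : nat) : Cplx R :=
  ((1 == k)%N%:R - (1 == l)%N%:R) - ((2 == k)%N%:R - (2 == l)%N%:R).
Definition rb (k l : nat) : Cplx R :=
  ((2 == k)%N%:R - (2 == l)%N%:R) - ((3 == k)%N%:R - (3 == l)%N%:R).
Definition rg (k l : nat) : Cplx R :=
  ((3 == k)%N%:R - (3 == l)%N%:R) - ((4 == k)%N%:R - (4 == l)%N%:R).

Lemma sl4_Ha : sl4 (Ha R). Proof. exact: sl4_diag. Qed.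
Lemma sl4_Hb : sl4 (Hb R). Proof. exact: sl4_diag. Qed.
Lemma sl4_Hg : sl4 (Hg R). Proof. exact: sl4_diag. Qed.
Lemma sl4_H0 : sl4 (H0 R).
Proof.
by apply: sl4D sl4_Hg; apply: sl4D sl4_Ha _; apply: sl4Z; exact: sl4_Hb.
Qed.

Lemma weight_e a k c i j v : index4 i -> index4 j -> i != j -> weight a k c v ->
  weight (a + ra i j) (k + (ra i j + 2%:R * rb i j + rg i j)) (c + rg i j)
    (e i j v).
Proof.
move=> hi hj ij [ha hc hk]; have hE := @sl4_E R i j hi hj ij.
have ea : ad_eigen (ra i j) (E i j) (Ha R) by apply: ad_eigenB; apply: ad_eigen_E.
have eb : ad_eigen (rb i j) (E i j) (Hb R) by apply: ad_eigenB; apply: ad_eigen_E.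
have eg : ad_eigen (rg i j) (E i j) (Hg R) by apply: ad_eigenB; apply: ad_eigen_E.
split; apply: gact_ad_eigen => //.
- exact: sl4_Ha.
- exact: sl4_Hg.
- exact: sl4_H0.
- by apply: ad_eigenD eg; apply: ad_eigenD ea _; apply: ad_eigenZ.
Qed.

Lemma weightD a k c u v : weight a k c u -> weight a k c v -> weight a k c (u + v).
Proof.
by move=> [h1 h2 h3] [h1' h2' h3']; split;
  rewrite linearD scalerDr ?h1 ?h1' ?h2 ?h2' ?h3 ?h3'.
Qed.

Lemma weightZ a k c d v : weight a k c v -> weight a k c (d *: v).
Proof.
by move=> [h1 h2 h3]; split;
  rewrite linearZ ?h1 ?h2 ?h3 /= !scalerA mulrC.
Qed.

Lemma weight_Hb a k c v : weight a k c v ->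
  gact pi (Hb R) v = ((k - a - c) / 2%:R) *: v.
Proof.
move=> [ha hc hk].
have : 2%:R *: gact pi (Hb R) v = (k - a - c) *: v.
  have h2b := sl4Z 2%:R sl4_Hb.
  move: hk; rewrite (gactD v (sl4D sl4_Ha h2b) sl4_Hg) (gactD v sl4_Ha h2b).
  rewrite (gactZ 2%:R v sl4_Hb) ha hc !scalerBl => <-.
  by rewrite addrAC addrK addrAC subrr add0r.
move=> h; rewrite mulrC -scalerA -h scalerA mulVf ?scale1r //.
Qed.

Arguments e_comm0 : clear implicits.
Arguments e_commr : clear implicits.
Arguments e_comml : clear implicits.
Arguments e_commH : clear implicits.

(** Highest weight vectors (zero included) for the block diagonal subalgebra;
    unlike in [hw_vectors], the weight has arbitrary complex entries, so that it
    can be shifted by roots without truncation. *)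
Definition hw (a k c : Cplx R) (v : V) :=
  [/\ weight a k c v, e 1 2 v = 0 & e 3 4 v = 0].

Lemma hw_vectorsE (n : nat) (k : int) (m : nat) v :
  hw_vectors pi (n, k, m) v <-> hw n%:R k%:~R m%:R v.
Proof.
by split => [[h1 h2 h3 h4 h5]|[[h3 h4 h5] h1 h2]]; split.
Qed.

Lemma hw_cast a k c a' k' c' v :
  hw a k c v -> a = a' -> k = k' -> c = c' -> hw a' k' c' v.
Proof. by move=> h <- <- <-. Qed.

Lemma weight_cast a k c a' k' c' v :
  weight a k c v -> a = a' -> k = k' -> c = c' -> weight a' k' c' v.
Proof. by move=> h <- <- <-. Qed.

(** The sl(2) relation [E12 E21 v = a v] on a vector killed by [E12]. *)
Lemma XaYa a k c v : weight a k c v -> e 1 2 v = 0 -> e 1 2 (e 2 1 v) = a *: v.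
Proof.
by move=> [ha _ _] h; rewrite (e_commH 1 2) // h linear0 add0r; exact: ha.
Qed.

Lemma XgYg a k c v : weight a k c v -> e 3 4 v = 0 -> e 3 4 (e 4 3 v) = c *: v.
Proof.
by move=> [_ hc _] h; rewrite (e_commH 3 4) // h linear0 add0r; exact: hc.
Qed.

(* Compares weights shifted by the roots of explicit matrix units. *)
Ltac wteq := rewrite /ra /rb /rg /=; ring.

Section Vector.
Variables (M k : Cplx R) (v : V).
Hypothesis hv : hw M k M v.

Let wv : weight M k M v. Proof. by case: hv. Qed.
Let xa : e 1 2 v = 0. Proof. by case: hv. Qed.
Let xg : e 3 4 v = 0. Proof. by case: hv. Qed.

Lemma hw_A_abg : hw (M + 1) (k + 2%:R) (M + 1) (e 1 4 v).
Proof.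
split; last 2 first.
- by rewrite (e_comm0 1 2 1 4) // xa linear0.
- by rewrite (e_comm0 3 4 1 4) // xg linear0.
by apply: (weight_cast (weight_e _ _ _ wv)) => //; wteq.
Qed.

Lemma hw_B_b : hw (M + 1) (k - 2%:R) (M + 1) (e 3 2 v).
Proof.
split; last 2 first.
- by rewrite (e_comm0 1 2 3 2) // xa linear0.
- by rewrite (e_comm0 3 4 3 2) // xg linear0.
by apply: (weight_cast (weight_e _ _ _ wv)) => //; wteq.
Qed.

Let w14 := hw_A_abg.
Let w32 := hw_B_b.

(** The next four lemmas correct [E24 v], [E13 v], [E31 v], [E42 v] to highest
    weight vectors, of weights [(M - 1, _, M + 1)] and [(M + 1, _, M - 1)]. *)
Lemma hw_E24 :
  hw (M - 1) (k + 2%:R) (M + 1) ((M + 1) *: e 2 4 v - e 2 1 (e 1 4 v)).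
Proof.
have [ww wa wg] := w14; split.
- rewrite -scaleN1r; apply: weightD; apply: weightZ.
    by apply: (weight_cast (weight_e _ _ _ wv)) => //; wteq.
  by apply: (weight_cast (weight_e _ _ _ ww)) => //; wteq.
- by rewrite linearB linearZ /= (e_commr 1 2 4) // xa linear0 add0r (XaYa ww wa) subrr.
- rewrite linearB linearZ /= (e_comm0 3 4 2 4) // xg linear0 scaler0 sub0r.
  by rewrite (e_comm0 3 4 2 1) // wg linear0 oppr0.
Qed.

Lemma hw_E13 :
  hw (M + 1) (k + 2%:R) (M - 1) ((M + 1) *: e 1 3 v + e 4 3 (e 1 4 v)).
Proof.
have [ww wa wg] := w14; split.
- rewrite -[e 4 3 _]scale1r; apply: weightD; apply: weightZ.
    by apply: (weight_cast (weight_e _ _ _ wv)) => //; wteq.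
  by apply: (weight_cast (weight_e _ _ _ ww)) => //; wteq.
- rewrite linearD linearZ /= (e_comm0 1 2 1 3) // xa linear0 scaler0 add0r.
  by rewrite (e_comm0 1 2 4 3) // wa linear0.
- rewrite linearD linearZ /= (e_comml 3 4 1) // xg linear0 sub0r (XgYg ww wg).
  by rewrite scalerN addNr.
Qed.

Lemma hw_E31 :
  hw (M - 1) (k - 2%:R) (M + 1) ((M + 1) *: e 3 1 v + e 2 1 (e 3 2 v)).
Proof.
have [ww wa wg] := w32; split.
- rewrite -[e 2 1 _]scale1r; apply: weightD; apply: weightZ.
    by apply: (weight_cast (weight_e _ _ _ wv)) => //; wteq.
  by apply: (weight_cast (weight_e _ _ _ ww)) => //; wteq.
- rewrite linearD linearZ /= (e_comml 1 2 3) // xa linear0 sub0r (XaYa ww wa).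
  by rewrite scalerN addNr.
- rewrite linearD linearZ /= (e_comm0 3 4 3 1) // xg linear0 scaler0 add0r.
  by rewrite (e_comm0 3 4 2 1) // wg linear0.
Qed.

Lemma hw_E42 :
  hw (M + 1) (k - 2%:R) (M - 1) ((M + 1) *: e 4 2 v - e 4 3 (e 3 2 v)).
Proof.
have [ww wa wg] := w32; split.
- rewrite -scaleN1r; apply: weightD; apply: weightZ.
    by apply: (weight_cast (weight_e _ _ _ wv)) => //; wteq.
  by apply: (weight_cast (weight_e _ _ _ ww)) => //; wteq.
- rewrite linearB linearZ /= (e_comm0 1 2 4 2) // xa linear0 scaler0 sub0r.
  by rewrite (e_comm0 1 2 4 3) // wa linear0 oppr0.
- by rewrite linearB linearZ /= (e_commr 3 4 2) // xg linear0 add0r (XgYg ww wg) subrr.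
Qed.

End Vector.

(** The four vectors of [hw_E24], [hw_E13], [hw_E31] and [hw_E42] vanish, as they
    do when all highest weights of the module have equal first and last entries. *)
Definition vanishing_relations (M : Cplx R) (v : V) :=
  [/\ (M + 1) *: e 2 4 v = e 2 1 (e 1 4 v),
      (M + 1) *: e 1 3 v = - e 4 3 (e 1 4 v),
      (M + 1) *: e 3 1 v = - e 2 1 (e 3 2 v) &
      (M + 1) *: e 4 2 v = e 4 3 (e 3 2 v)].

(** * The shift operators under the vanishing relations *)

Lemma e21_e43 v : e 2 1 (e 4 3 v) = e 4 3 (e 2 1 v).
Proof. exact: (e_comm0 2 1 4 3). Qed.

(** The vanishing relations turn the two middle terms of [A_b] into multiples
    of the last one, with opposite sign to it; hence only one copy is left. *)
Lemma A_bE M k v : hw M k M v -> vanishing_relations M v ->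
  A_b pi v = (M + 1) ^+ 2 *: e 2 3 v + e 2 1 (e 4 3 (e 1 4 v)).
Proof.
move=> [[ha hg _] _ _] [h24 h13 _ _].
have a1 : act1 pi (Hg R) v = (M + 1) *: v by rewrite /act1 hg scalerDl scale1r.
have a2 : act1 pi (Ha R) v = (M + 1) *: v by rewrite /act1 ha scalerDl scale1r.
have a3 : act1 pi (Ha R) (act1 pi (Hg R) v) = (M + 1) ^+ 2 *: v.
  by rewrite a1 /act1 linearZ /= ha !scalerA -scalerDl; congr (_ *: _); ring.
have t1 : gact pi (Xab R) ((M + 1) *: v) = - e 4 3 (e 1 4 v).
  by rewrite linearZ /= -h13.
have t2 : gact pi (Xbg R) ((M + 1) *: v) = e 2 1 (e 1 4 v).
  by rewrite linearZ /= -h24.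
rewrite /A_b a3 a1 a2 t1 t2 /Ya /Yg !E_tr linearZ /= linearN opprK -e21_e43.
by rewrite addrK.
Qed.

Lemma B_abgE M k v : hw M k M v -> vanishing_relations M v ->
  B_abg pi v = (M + 1) ^+ 2 *: e 4 1 v + e 2 1 (e 4 3 (e 3 2 v)).
Proof.
move=> [[ha hg _] _ _] [_ _ h31 h42].
have a1 : act1 pi (Hg R) v = (M + 1) *: v by rewrite /act1 hg scalerDl scale1r.
have a2 : act1 pi (Ha R) v = (M + 1) *: v by rewrite /act1 ha scalerDl scale1r.
have a3 : act1 pi (Ha R) (act1 pi (Hg R) v) = (M + 1) ^+ 2 *: v.
  by rewrite a1 /act1 linearZ /= ha !scalerA -scalerDl; congr (_ *: _); ring.
have t1 : gact pi (Ybg R) ((M + 1) *: v) = e 4 3 (e 3 2 v).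
  by rewrite /Ybg E_tr linearZ /= -h42.
have t2 : gact pi (Yab R) ((M + 1) *: v) = - e 2 1 (e 3 2 v).
  by rewrite /Yab E_tr linearZ /= -h31.
rewrite /B_abg a3 a1 a2 t1 t2 /Ya /Yg /Yb /Yabg !E_tr linearZ /= linearN opprK.
by rewrite -e21_e43 addrK.
Qed.

Lemma hw_A_b M k v : hw M k M v -> vanishing_relations M v ->
  hw (M - 1) (k + 2%:R) (M - 1) (A_b pi v).
Proof.
move=> hv hl; rewrite (A_bE hv hl); have [ww wa wg] := hw_A_abg hv.
have [wv xa xg] := hv; have [h24 h13 _ _] := hl.
split.
- rewrite -[e 2 1 _]scale1r; apply: weightD; apply: weightZ.
    by apply: (weight_cast (weight_e _ _ _ wv)) => //; wteq.
  by apply: (weight_cast (weight_e _ _ _ (weight_e _ _ _ ww))) => //; wteq.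
- rewrite linearD linearZ /= (e_commr 1 2 3) // xa linear0 add0r e21_e43.
  rewrite (e_comm0 1 2 4 3) // (XaYa ww wa) linearZ /= -[e 4 3 _]opprK -h13.
  by rewrite scalerN scalerA -expr2 subrr.
- rewrite linearD linearZ /= (e_comml 3 4 2) // xg linear0 sub0r.
  rewrite (e_comm0 3 4 2 1) // (XgYg ww wg) linearZ /= -h24.
  by rewrite scalerN scalerA -expr2 addNr.
Qed.

Lemma hw_B_abg M k v : hw M k M v -> vanishing_relations M v ->
  hw (M - 1) (k - 2%:R) (M - 1) (B_abg pi v).
Proof.
move=> hv hl; rewrite (B_abgE hv hl); have [ww wa wg] := hw_B_b hv.
have [wv xa xg] := hv; have [_ _ h31 h42] := hl.
split.
- rewrite -[e 2 1 _]scale1r; apply: weightD; apply: weightZ.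
    by apply: (weight_cast (weight_e _ _ _ wv)) => //; wteq.
  by apply: (weight_cast (weight_e _ _ _ (weight_e _ _ _ ww))) => //; wteq.
- rewrite linearD linearZ /= (e_comml 1 2 4) // xa linear0 sub0r e21_e43.
  rewrite (e_comm0 1 2 4 3) // (XaYa ww wa) linearZ /= -h42.
  by rewrite scalerN scalerA -expr2 addNr.
- rewrite linearD linearZ /= (e_commr 3 4 1) // xg linear0 add0r.
  rewrite (e_comm0 3 4 2 1) // (XgYg ww wg) linearZ /= -[e 2 1 _]opprK -h31.
  by rewrite scalerN scalerA -expr2 subrr.
Qed.

(** The linear algebra behind [relation_Hb]: with [r = M + 1] and [s = M + 2],
    the coefficients of [z] agree because [r^2 - s M = 1]. *)
Lemma combination_identity (M h : Cplx R) (x y z t : V) :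
  (M + 1) ^+ 2 *: ((M + 2%:R) ^+ 2 *: x + (M + 2%:R) *: z)
   = (M + 2%:R) ^+ 2 *: ((M + 1) ^+ 2 *: (x - h *: t) + (M *: z - y))
     + ((M + 2%:R) ^+ 2 *: y + (M + 2%:R) *: z)
     + ((M + 1) ^+ 2 * (M + 2%:R) ^+ 2 * h) *: t.
Proof.
have zE : ((M + 1) ^+ 2 * (M + 2%:R)) *: z =
          ((M + 2%:R) ^+ 2 * M) *: z + (M + 2%:R) *: z.
  by rewrite -scalerDl; congr (_ *: _); ring.
rewrite !(scalerDr, scalerN, scalerA) zE [_ * (M + 1) ^+ 2]mulrC.
rewrite -!addrA; congr (_ + _).
by rewrite [RHS]addrCA addKr [- _ + _]addrCA addNr addr0.
Qed.

(** * The two relations between the compositions of shift operators *)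

Section Relations.
Variables (M k : Cplx R) (v : V).
Hypotheses (hv : hw M k M v) (M2 : M + 2%:R != 0).
Hypotheses (lv : vanishing_relations M v) (lu : vanishing_relations (M + 1) (e 3 2 v))
  (lw : vanishing_relations (M + 1) (e 1 4 v)).

(* The eigenvalue of [Hb] on [v]. *)
Let h : Cplx R := (k - M - M) / 2%:R.
(* All the compositions of shift operators at [v] are combinations of these
   three vectors and [v]. *)
Let x := e 2 3 (e 3 2 v).
Let y := e 4 1 (e 1 4 v).
Let z := e 2 1 (e 4 2 (e 1 4 v)).

Let M11 : M + 1 + 1 = M + 2%:R. Proof. ring. Qed.

Let Zw : e 2 1 (e 4 3 (e 3 2 (e 1 4 v))) = (M + 2%:R) *: z.
Proof. by have [_ _ _ <-] := lw; rewrite linearZ /= M11. Qed.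

Let Zu : e 2 1 (e 4 3 (e 1 4 (e 3 2 v))) = (M + 2%:R) *: z.
Proof. by rewrite (e_comm0 1 4 3 2). Qed.

Lemma A_bB_b_xyz : A_b pi (B_b pi v) = (M + 2%:R) ^+ 2 *: x + (M + 2%:R) *: z.
Proof.
rewrite /B_b /Yb E_tr (A_bE (hw_B_b hv) lu) Zu M11 //.
Qed.

Lemma B_abgA_abg_xyz :
  B_abg pi (A_abg pi v) = (M + 2%:R) ^+ 2 *: y + (M + 2%:R) *: z.
Proof. by rewrite /A_abg (B_abgE (hw_A_abg hv) lw) Zw M11. Qed.

Let e43_e31_w : e 4 3 (e 3 1 (e 1 4 v)) = - z.
Proof.
apply: (scalerI M2); rewrite scalerN -Zw -linearZ /= -M11.
by have [_ _ -> _] := lw; rewrite linearN /= e21_e43.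
Qed.

Let e31_e43_w : e 3 1 (e 4 3 (e 1 4 v)) = - z - y.
Proof. by rewrite (e_comml 3 1 4) // e43_e31_w. Qed.

Lemma B_bA_b_xyz :
  B_b pi (A_b pi v) = (M + 1) ^+ 2 *: (x - h *: v) + (M *: z - y).
Proof.
rewrite /B_b /Yb E_tr (A_bE hv lv) linearD linearZ /=; congr (_ *: _ + _).
  rewrite /x (e_commH 2 3) //; have [wv _ _] := hv.
  by rewrite -(weight_Hb wv) addrK.
rewrite (e_commr 3 2 1) // e31_e43_w (e_comml 3 2 4) // linearB /= Zw.
have -> : M *: z = (M + 2%:R) *: z - z - z.
  by rewrite [in LHS](_ : M = M + 2%:R - 1 - 1); [rewrite !scalerBl scale1r | ring].
by rewrite -/z !addrA.
Qed.

(** This is [[E13, E31] v = (Ha + Hb) v], in which the vanishing relations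
    express [E13 v] and [E31 v] by [E14 v] and [E32 v]. *)
Lemma xy_diff : x - y = ((M + 1) * (M + h)) *: v.
Proof.
have e1 : (M + 1) *: e 1 3 (e 3 1 v) = z + x.
  rewrite -linearZ /=; have [_ _ -> _] := lv.
  rewrite linearN /= (e_comml 1 3 2) // opprB addrC; congr (_ + _).
  apply: (scalerI M2); rewrite -Zu scalerN -linearZ /= -M11.
  by have [_ -> _ _] := lu; rewrite linearN opprK.
have e2 : (M + 1) *: e 3 1 (e 1 3 v) = z + y.
  rewrite -linearZ /=; have [_ -> _ _] := lv.
  by rewrite linearN /= e31_e43_w opprB opprK addrC.
have : (M + 1) *: gact pi (E 1 1 - E 3 3) v = x - y.
  have -> : x - y = (z + x) - (z + y) by rewrite opprD addrACA subrr add0r.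
  by rewrite -e1 -e2 -scalerBr (e_commH 1 3) // (addrC (e 3 1 _)) addrK.
move=> <-; rewrite -scalerA; congr (_ *: _).
have -> : E 1 1 - E 3 3 = Ha R + Hb R by rewrite addrA subrK.
rewrite (gactD v sl4_Ha sl4_Hb) scalerDl.
have [wv _ _] := hv; rewrite (weight_Hb wv).
by case: wv => ->.
Qed.

Lemma relation_diff :
  A_b pi (B_b pi v) - B_abg pi (A_abg pi v) =
    ((M + 2%:R) ^+ 2 * (M + 1) * (M + h)) *: v.
Proof.
rewrite A_bB_b_xyz B_abgA_abg_xyz opprD addrACA subrr addr0 -scalerBr.
by rewrite xy_diff !scalerA mulrA.
Qed.

(** This is [[E23, E32] v = Hb v] expressed by the shift operators. *)
Lemma relation_Hb :
  (M + 1) ^+ 2 *: A_b pi (B_b pi v)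
   = (M + 2%:R) ^+ 2 *: B_b pi (A_b pi v) + B_abg pi (A_abg pi v)
     + ((M + 1) ^+ 2 * (M + 2%:R) ^+ 2 * h) *: v.
Proof.
rewrite A_bB_b_xyz B_abgA_abg_xyz B_bA_b_xyz.
exact: combination_identity.
Qed.
End Relations.

End Module.

(** * The ladder of highest weights *)

Section LadderModule.
Variables (R : realType) (V : lmodType (Cplx R)) (pi : gK_module V).
Notation E := (@E R).
Notation e i j := (gact pi (E i j)).
Notation hw := (hw pi).
Notation vanishing_relations := (vanishing_relations pi).

Section Ladder.
Variable n : nat.
Hypothesis n_ge1 : (1 <= n)%N.
Hypothesis weights_pi : K_highest_weights pi =
  [set w | exists p q : nat, w = ladder_weight n p q].
Hypothesis mult1_pi : forall p q : nat, multiplicity_one pi (ladder_weight n p q).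

Notation W p q := (hw_vectors pi (ladder_weight n p q)).
Notation Mf p q := ((n + p + q)%N%:R : Cplx R).
Notation kf p q := (2%:R * p%:R - 2%:R * q%:R : Cplx R).

(** No nonzero highest weight vector has a weight outside the ladder. *)
Lemma off_ladder (a b : nat) (k : int) v :
  (forall p q, (a, k, b) <> ladder_weight n p q) ->
  hw a%:R k%:~R b%:R v -> v = 0.
Proof.
move=> off /hw_vectorsE hv; apply/eqP/negPn/negP => v0.
have : K_highest_weights pi (a, k, b) by exists v.
by rewrite weights_pi => -[p [q]]; exact: off.
Qed.

Lemma W_hw p q v : W p q v <-> hw (Mf p q) (kf p q) (Mf p q) v.
Proof.
by rewrite hw_vectorsE rmorphB /= !rmorphM.
Qed.

Lemma Mf_pred p q : ((n + p + q).-1%N)%:R = Mf p q - 1.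
Proof.
by rewrite -subn1 natrB //; lia.
Qed.

Lemma Mf2_neq0 p q : Mf p q + 2%:R != 0.
Proof. by rewrite -natrD pnatr_eq0 addn2. Qed.
Lemma Mf_neq0 p q : Mf p q != 0.
Proof. by rewrite pnatr_eq0; lia. Qed.

Lemma W_vanishing_relations p q v : W p q v -> vanishing_relations (Mf p q) v.
Proof.
move=> /W_hw hv.
have kU : kf p q + 2%:R = (2 * p%:Z - 2 * q%:Z + 2)%:~R.
  by rewrite rmorphD rmorphB /= !rmorphM.
have kD : kf p q - 2%:R = (2 * p%:Z - 2 * q%:Z - 2)%:~R.
  by rewrite !rmorphB /= !rmorphM.
split; apply/eqP.
- rewrite -subr_eq0; apply/eqP; apply: (@off_ladder (n + p + q).-1 (n + p + q).+1);
    last by apply: (hw_cast (hw_E24 hv) _ kU); rewrite ?Mf_pred ?natr1.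
  by move=> p' q' []; lia.
- rewrite -addr_eq0; apply/eqP; apply: (@off_ladder (n + p + q).+1 (n + p + q).-1);
    last by apply: (hw_cast (hw_E13 hv) _ kU); rewrite ?Mf_pred ?natr1.
  by move=> p' q' []; lia.
- rewrite -addr_eq0; apply/eqP; apply: (@off_ladder (n + p + q).-1 (n + p + q).+1);
    last by apply: (hw_cast (hw_E31 hv) _ kD); rewrite ?Mf_pred ?natr1.
  by move=> p' q' []; lia.
- rewrite -subr_eq0; apply/eqP; apply: (@off_ladder (n + p + q).+1 (n + p + q).-1);
    last by apply: (hw_cast (hw_E42 hv) _ kD); rewrite ?Mf_pred ?natr1.
  by move=> p' q' []; lia.
Qed.

(* Ring identities between casts of sums and successors of naturals. *)
Ltac nat_ring := rewrite ?(natrD, =^~ natr1) /=; ring.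

Lemma W_A_abg p q v : W p q v -> W p.+1 q (A_abg pi v).
Proof.
by move=> /W_hw hv; apply/W_hw; apply: (hw_cast (hw_A_abg hv)); nat_ring.
Qed.

Lemma W_B_b p q v : W p q v -> W p q.+1 (B_b pi v).
Proof.
move=> /W_hw hv; apply/W_hw; rewrite /B_b /Yb E_tr.
by apply: (hw_cast (hw_B_b hv)); nat_ring.
Qed.

Lemma W_A_b p q v : W p q.+1 v -> W p q (A_b pi v).
Proof.
move=> hv; apply/W_hw.
have := hw_A_b (proj1 (W_hw _ _ _) hv) (W_vanishing_relations hv).
by move=> h; apply: (hw_cast h); nat_ring.
Qed.

Lemma W_B_abg p q v : W p.+1 q v -> W p q (B_abg pi v).
Proof.
move=> hv; apply/W_hw.
have := hw_B_abg (proj1 (W_hw _ _ _) hv) (W_vanishing_relations hv).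
by move=> h; apply: (hw_cast h); nat_ring.
Qed.

(** At the edges of the ladder the shifted weight is not on the ladder. *)
Lemma A_b_bottom p v : W p 0 v -> A_b pi v = 0.
Proof.
move=> hv; have h := hw_A_b (proj1 (W_hw _ _ _) hv) (W_vanishing_relations hv).
apply: (@off_ladder (n + p + 0).-1 (n + p + 0).-1 (2 * p%:Z + 2)).
  by move=> p' q' []; lia.
by apply: (hw_cast h); rewrite ?Mf_pred ?rmorphD ?rmorphM ?mulr0 ?subr0.
Qed.

Lemma B_abg_bottom q v : W 0 q v -> B_abg pi v = 0.
Proof.
move=> hv; have h := hw_B_abg (proj1 (W_hw _ _ _) hv) (W_vanishing_relations hv).
apply: (@off_ladder (n + 0 + q).-1 (n + 0 + q).-1 (- (2 * q%:Z) - 2)).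
  by move=> p' q' []; lia.
apply: (hw_cast h); rewrite ?Mf_pred //.
by rewrite rmorphB rmorphN rmorphM mulr0 sub0r.
Qed.

Lemma A_bZ c v : A_b pi (c *: v) = c *: A_b pi v.
Proof. by rewrite /A_b /act1 !(linearZ, =^~ scalerDr, =^~ scalerBr) /=. Qed.
Lemma B_abgZ c v : B_abg pi (c *: v) = c *: B_abg pi v.
Proof. by rewrite /B_abg /act1 !(linearZ, =^~ scalerDr, =^~ scalerBr) /=. Qed.
Lemma A_abgZ c v : A_abg pi (c *: v) = c *: A_abg pi v.
Proof. by rewrite /A_abg linearZ. Qed.
Lemma B_bZ c v : B_b pi (c *: v) = c *: B_b pi v.
Proof. by rewrite /B_b linearZ. Qed.

(** Between two lines, [S T] and [T S] are the same scalar; it is the product of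
    the coefficients of [S] and [T] in fixed generators. *)
Lemma swap_scalar (w w' : nat * int * nat) (S T : V -> V) (c : Cplx R) :
  multiplicity_one pi w -> multiplicity_one pi w' ->
  (forall a v, S (a *: v) = a *: S v) -> (forall a v, T (a *: v) = a *: T v) ->
  (forall v, hw_vectors pi w v -> hw_vectors pi w' (S v)) ->
  (forall v, hw_vectors pi w' v -> hw_vectors pi w (T v)) ->
  (forall v, hw_vectors pi w v -> T (S v) = c *: v) ->
  forall v, hw_vectors pi w' v -> S (T v) = c *: v.
Proof.
move=> [u [hu u0 genu]] [u' [hu' u'0 genu']] SZ TZ hS hT TS v hv.
have [r ->] := genu' v hv; rewrite TZ SZ !scalerA mulrC -scalerA; congr (_ *: _).
have [s es] := genu' _ (hS u hu); have [t et] := genu _ (hT u' hu').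
rewrite et SZ es scalerA; congr (_ *: _).
apply/eqP; rewrite eq_sym -subr_eq0.
suff : (c - t * s) *: u == 0 by rewrite scaler_eq0 (negbTE u0) orbF.
by rewrite scalerBl -TS // es TZ et scalerA mulrC subrr.
Qed.

(** On the ladder, [Hb] acts by [p - q - M]. *)
Lemma W_relations p q v : W p q v ->
  A_b pi (B_b pi v) - B_abg pi (A_abg pi v) =
    ((Mf p q + 2%:R) ^+ 2 * (Mf p q + 1) * (p%:R - q%:R)) *: v /\
  (Mf p q + 1) ^+ 2 *: A_b pi (B_b pi v)
   = (Mf p q + 2%:R) ^+ 2 *: B_b pi (A_b pi v) + B_abg pi (A_abg pi v)
     + ((Mf p q + 1) ^+ 2 * (Mf p q + 2%:R) ^+ 2 * (p%:R - q%:R - Mf p q)) *: v.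
Proof.
move=> hv; have hw := proj1 (W_hw _ _ _) hv.
have lu : vanishing_relations (Mf p q + 1) (e 3 2 v).
  have := W_vanishing_relations (W_B_b hv).
  by rewrite addnS -natr1 /B_b /Yb E_tr.
have lw : vanishing_relations (Mf p q + 1) (e 1 4 v).
  by have := W_vanishing_relations (W_A_abg hv); rewrite addnS addSn -natr1.
have hE : (kf p q - Mf p q - Mf p q) / 2%:R = p%:R - q%:R - Mf p q by field.
have M2 := Mf2_neq0 p q; have lv := W_vanishing_relations hv.
split; last by rewrite (relation_Hb hw M2 lv lu lw) hE.
rewrite (relation_diff hw M2 lv lu lw) hE.
by congr (_ * _ *: _); ring.
Qed.

(** Eliminating [B_abg A_abg] from [W_relations] leaves one equation with
    leading coefficient [(M + 1)^2 - 1 = M (M + 2)], nonzero as [n >= 1]. *)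
Lemma A_bB_b_solve p q v (c a : Cplx R) : W p q v ->
  B_b pi (A_b pi v) = c *: v ->
  Mf p q * (Mf p q + 2%:R) * a =
    (Mf p q + 2%:R) ^+ 2 * c
    - (Mf p q + 2%:R) ^+ 2 * (Mf p q + 1) * (p%:R - q%:R)
    + (Mf p q + 1) ^+ 2 * (Mf p q + 2%:R) ^+ 2 * (p%:R - q%:R - Mf p q) ->
  A_b pi (B_b pi v) = a *: v.
Proof.
move=> hv hc ha; have [rd rH] := W_relations hv.
apply: (scalerI (mulf_neq0 (Mf_neq0 p q) (Mf2_neq0 p q))).
rewrite [RHS]scalerA ha.
have -> : Mf p q * (Mf p q + 2%:R) = (Mf p q + 1) ^+ 2 - 1 :> Cplx R by ring.
rewrite scalerBl scale1r rH hc -(subrK (B_abg pi (A_abg pi v)) (A_b pi _)) rd.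
rewrite scalerA [in RHS]scalerDl [in RHS]scalerBl.
set X := _ *: v; set D := _ *: v; set Y := _ *: v; set B := B_abg _ _.
by rewrite (addrAC X B D) (addrC Y) opprD addrA addrK addrAC.
Qed.

Lemma A_bB_b_scalar p q v : W p q v ->
  A_b pi (B_b pi v) = AbBb_expr n%:R p%:R q%:R *: v.
Proof.
elim: q v => [|q IH] v hv.
  apply: (A_bB_b_solve (c := 0) hv).
    by rewrite (A_b_bottom hv) /B_b linear0 scale0r.
  by rewrite /AbBb_expr !natrD; ring.
apply: (A_bB_b_solve (c := AbBb_expr n%:R p%:R q%:R) hv); last first.
  by rewrite /AbBb_expr !natrD -!natr1; ring.
by apply: (swap_scalar (mult1_pi p q) (mult1_pi p q.+1) B_bZ A_bZ
  (@W_B_b p q) (@W_A_b p q) IH).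
Qed.

Lemma B_bA_b_scalar p q v : W p q v ->
  B_b pi (A_b pi v) = BbAb_expr n%:R p%:R q%:R *: v.
Proof.
case: q => [|q] hv.
  by rewrite (A_b_bottom hv) /B_b linear0 /BbAb_expr !mul0r oppr0 scale0r.
have -> : BbAb_expr n%:R p%:R q.+1%:R = AbBb_expr n%:R p%:R q%:R :> Cplx R.
  by rewrite /AbBb_expr /BbAb_expr -!natr1; ring.
exact: (swap_scalar (mult1_pi p q) (mult1_pi p q.+1) B_bZ A_bZ
  (@W_B_b p q) (@W_A_b p q) (@A_bB_b_scalar p q)).
Qed.

Lemma B_abgA_abg_scalar p q v : W p q v ->
  B_abg pi (A_abg pi v) = BabgAabg_expr n%:R p%:R q%:R *: v.
Proof.
move=> hv; have [rd _] := W_relations hv.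
rewrite -[LHS](subKr (A_b pi (B_b pi v))) rd (A_bB_b_scalar hv) -scalerBl.
by congr (_ *: _); rewrite /AbBb_expr /BabgAabg_expr !natrD; ring.
Qed.

Lemma A_abgB_abg_scalar p q v : W p q v ->
  A_abg pi (B_abg pi v) = AabgBabg_expr n%:R p%:R q%:R *: v.
Proof.
case: p => [|p] hv.
  by rewrite (B_abg_bottom hv) /A_abg linear0 /AabgBabg_expr !mul0r oppr0 scale0r.
have -> : AabgBabg_expr n%:R p.+1%:R q%:R = BabgAabg_expr n%:R p%:R q%:R :> Cplx R.
  by rewrite /AabgBabg_expr /BabgAabg_expr -!natr1; ring.
exact: (swap_scalar (mult1_pi p q) (mult1_pi p.+1 q) A_abgZ B_abgZ
  (@W_A_abg p q) (@W_B_abg p q) (@B_abgA_abg_scalar p q)).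
Qed.
End Ladder.
End LadderModule.

Theorem proposition17 (R : realType) (V : lmodType (Cplx R)) (pi : gK_module V)
    (n : nat) (n_ge1 : (1 <= n)%N) (unitary_pi : unitary_gK_module pi)
    (weights_pi : K_highest_weights pi =
       [set w | exists p q : nat, w = ladder_weight n p q])
    (mult1_pi : forall p q : nat, multiplicity_one pi (ladder_weight n p q)) :
  exists AbBb BabgAabg BbAb AabgBabg : nat -> nat -> Cplx R,
    (forall p q : nat,
      let W := hw_vectors pi (ladder_weight n p q) in
      [/\ acts_by_scalar (A_b pi \o B_b pi) W (AbBb p q),
          acts_by_scalar (B_abg pi \o A_abg pi) W (BabgAabg p q),
          acts_by_scalar (B_b pi \o A_b pi) W (BbAb p q) &
          acts_by_scalar (A_abg pi \o B_abg pi) W (AabgBabg p q)]) /\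
    (forall p q : nat,
      [/\ AbBb p q = AbBb_expr n%:R p%:R q%:R,
          BabgAabg p q = BabgAabg_expr n%:R p%:R q%:R,
          BbAb p q = BbAb_expr n%:R p%:R q%:R &
          AabgBabg p q = AabgBabg_expr n%:R p%:R q%:R]) /\
    (forall p q : nat,
      let M : Cplx R := (n + p + q)%:R in
      [/\ 1 / (M + 2%:R) ^+ 2 * AbBb p q - 1 / (M + 1) ^+ 2 * BbAb p q
            - 1 / ((M + 1) ^+ 2 * (M + 2%:R) ^+ 2) * BabgAabg p q
            = - n%:R - 2%:R * q%:R,
          1 / ((M + 1) * (M + 2%:R) ^+ 2) * AbBb p q
            - 1 / ((M + 1) * (M + 2%:R) ^+ 2) * BabgAabg p q
            = p%:R - q%:R &
          1 / (M + 1) ^+ 2 * AabgBabg p q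
            - 1 / (M + 2%:R) ^+ 2 * BabgAabg p q
            + 1 / ((M + 1) ^+ 2 * (M + 2%:R) ^+ 2) * AbBb p q
            = n%:R + 2%:R * p%:R]) /\
    (forall p q : nat,
      BbAb_expr n%:R p%:R q%:R = AbBb_expr n%:R p%:R (q%:R - 1) :> Cplx R /\
      AabgBabg_expr n%:R p%:R q%:R = BabgAabg_expr n%:R (p%:R - 1) q%:R
        :> Cplx R) /\
    (forall p q : nat,
      [/\ AbBb p q <= 0, BabgAabg p q <= 0, BbAb p q <= 0 &
          AabgBabg p q <= 0]).
Proof.
exists (fun p q => AbBb_expr n%:R p%:R q%:R),
  (fun p q => BabgAabg_expr n%:R p%:R q%:R),
  (fun p q => BbAb_expr n%:R p%:R q%:R),
  (fun p q => AabgBabg_expr n%:R p%:R q%:R); split; [|split; [|split; [|split]]].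
- move=> p q W.
  have W0 : exists2 v, W v & v != 0
    by have [v [hv v0 _]] := mult1_pi p q; exists v.
  split; split => // v hv /=.
  + exact: (A_bB_b_scalar n_ge1 weights_pi mult1_pi).
  + exact: (B_abgA_abg_scalar n_ge1 weights_pi mult1_pi).
  + exact: (B_bA_b_scalar n_ge1 weights_pi mult1_pi).
  + exact: (A_abgB_abg_scalar n_ge1 weights_pi mult1_pi).
- by [].
- move=> p q M.
  have M1 : n%:R + p%:R + q%:R + 1 != 0 :> Cplx R.
    by rewrite -!natrD natr1 pnatr_eq0.
  have M2 : n%:R + p%:R + q%:R + 2%:R != 0 :> Cplx R.
    by rewrite -!natrD addn2 pnatr_eq0.
  rewrite /M !natrD /AbBb_expr /BabgAabg_expr /BbAb_expr /AabgBabg_expr.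
  by split; field; rewrite ?M1 ?M2.
- move=> p q; rewrite /AbBb_expr /BabgAabg_expr /BbAb_expr /AabgBabg_expr.
  by split; ring.
- move=> p q; rewrite /AbBb_expr /BabgAabg_expr /BbAb_expr /AabgBabg_expr.
  by split; rewrite oppr_le0 !(natr1, =^~ natrD, =^~ natrM) ler0n.
Qed.
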